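(* Let $X$ be an infinite-dimensional real normed space of density $\kappa$. Suppose that there exists $\theta>1$ with the following property: for every subspace $Z$ of $X$ with $\mathrm{dens}(Z)<\kappa$ there exists a vector $x\in S_X$ such that $\mathrm{dist}(x,S_Z)\ge\theta$. Then $\gamma^*(X)\le\frac{2}{\theta}$.
   Context: $S_X$ denotes the unit sphere of $X$; $\mathrm{dist}(x,A)=\inf_{a\in A}\|x-a\|$ (equal to $+\infty$ if $A=\emptyset$). $\mathrm{dens}(X)$, the density of $X$, is the smallest cardinality of a subset of $X$ whose linear span is dense in $X$ (so $\mathrm{dens}(Z)<\omega$ means $Z$ is finite-dimensional). A set $P\subseteq X$ is $r$-separated if $\|x-y\|\ge r$ for all distinct $x,y\in P$, and $r$-dense if for every $x\in X$ there is $p\in P$ with $\|x-p\|\le r$. The lattice simultaneous packing and covering constant is $\gamma^*(X)=\inf\{r>0:\text{there exists an }r\text{-dense and }2\text{-separated additive subgroup }P\subseteq X\}$. *)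

(* Defs.v *)
From HB Require Import structures.
From mathcomp Require Import all_boot all_order all_algebra.
From mathcomp Require Import all_classical all_reals ereal topology normedtype.

Set Implicit Arguments.
Unset Strict Implicit.
Unset Printing Implicit Defensive.

Import Order.TTheory GRing.Theory Num.Theory.
Import numFieldNormedType.Exports.
Local Open Scope classical_set_scope.
Local Open Scope card_scope.
Local Open Scope ring_scope.

Definition card_lt (T U : Type) (A : set T) (B : set U) : Prop :=
  A #<= B /\ ~ (A #= B).

Section NormedSpace.
Context {R : realType} {X : normedModType R}.
Implicit Types (A D P Z : set X) (x : X) (r : R).

(* [in Z] is the boolean predicate given by classical membership in Z. *)
Definition linear_subspace Z : Prop := submod_closed [in Z].

Definition additive_subgroup P : Prop := zmod_closed [in P].

Definition linear_span D : set X := smallest linear_subspace D.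

(* The closure is taken in X; it contains Z if and only if the span of D is
   dense in Z for the induced topology. *)
Definition spans_densely Z D : Prop :=
  D `<=` Z /\ Z `<=` closure (linear_span D).

(* Cardinals are represented by arbitrary sets, up to equipotence:
   [has_density Z kappa] reads "dens Z = |kappa|". *)
Definition has_density (U : Type) Z (kappa : set U) : Prop :=
  (exists2 D, spans_densely Z D & D #= kappa) /\
  (forall D, spans_densely Z D -> kappa #<= D).

(* dens Z < |kappa|; as dens Z is the cardinality of a subset of X, it suffices
   to represent it by such a subset. *)
Definition density_lt (U : Type) Z (kappa : set U) : Prop :=
  exists2 lambda : set X, has_density Z lambda & card_lt lambda kappa.

Definition unit_sphere Z : set X := [set z | Z z /\ `|z| = 1].

(* Extended-real valued, so that the distance to the empty set is +oo. *)
Definition dist_set x A : \bar R := ereal_inf [set `|x - a|%:E | a in A].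

Definition separated_set r P : Prop :=
  forall x y, P x -> P y -> x <> y -> r <= `|x - y|.

Definition dense_set r P : Prop :=
  forall x, exists2 p, P p & `|x - p| <= r.

End NormedSpace.

Definition infinite_dimensional (R : realType) (X : normedModType R) : Prop :=
  ~ exists2 D : set X, finite_set D & linear_span D = [set: X].

Definition gamma_star (R : realType) (X : normedModType R) : \bar R :=
  ereal_inf [set r%:E | r in [set r : R | 0 < r /\
    exists P : set X,
      [/\ additive_subgroup P, dense_set r P & separated_set 2 P]]].

(* Main.v *)
Require Import Defs.
From HB Require Import structures.
From mathcomp Require Import all_boot all_order all_algebra.
From mathcomp Require Import all_classical all_reals ereal topology normedtype.
From mathcomp Require Import wochoice lra.
Set Implicit Arguments.
Unset Strict Implicit.
Unset Printing Implicit Defensive.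

Import Order.TTheory GRing.Theory Num.Theory.
Import numFieldNormedType.Exports.
Local Open Scope classical_set_scope.
Local Open Scope ring_scope.

(** Index a dense subset of X by a well-order all of whose initial segments have
fewer than kappa elements, and choose, by transfinite recursion along this
order, one generator for each element x of the dense subset.  Let Q be the
subgroup generated by the earlier generators, and put r = 2 / theta.  If some
element of Q lies within r of x, nothing needs to be added.  Otherwise the span
Z of Q and x has density less than kappa, the hypothesis gives a unit vector u
at distance at least theta from the unit sphere of Z, and the new generator is
x + r u, which lies at distance exactly r from x.

The group stays 2-separated: a new element has the form
q + n (x + r u) = n r (u + z) with n nonzero, q in Q and z in Z.  The triangle
inequality gives |u + z| >= theta as soon as |z| >= 1 ([norm_addr_far]), and
|u + z| >= theta / 2 for every z in Z ([norm_addr_half]).  The second bound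
settles |n| >= 2.  For |n| = 1, the norm of z is the distance from x to an
element of Q, divided by r; as x is farther than r from Q, it exceeds 1 and the
first bound applies ([separated_setU1]).  At limit stages Q is the union of a
chain of 2-separated subgroups ([separated_subgroup_span_chain]).  The final
group comes within r of every element of a dense set, so it is
(r + eps)-dense for every eps > 0, and the infimum is at most r.

Set theory enters in two places.  A set of kappa vectors with dense span must
be turned into a dense set of cardinality kappa, which needs kappa to be
infinite (finite-dimensional subspaces are closed,
[closed_finite_linear_span]) and finite sequences over an infinite set to be no
more numerous than its elements ([card_le_seq], from kappa * kappa = kappa).
And dens Z exists as a cardinal because every nonempty family of sets has a
member of least cardinality ([exists_least_card]). *)

(** * Arithmetic of infinite cardinals *)

Section Cardinals.
Local Open Scope card_scope.
Context {T : pointedType}.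
Implicit Types A B C : set T.

Lemma card_leEx (U : Type) (V : pointedType) (A : set U) (B : set V) :
  A #<= B <-> exists2 f : U -> V, (forall x, A x -> B (f x)) &
    forall x y, A x -> A y -> f x = f y -> x = y.
Proof.
split=> [/pcard_leP /injfunPex [f fB finj]|[f fB finj]].
  by exists f => // x y Ax Ay; apply: finj; exact: mem_set.
apply/pcard_leP/injfunPex; exists f => // x y /set_mem Ax /set_mem Ay.
exact: finj.
Qed.

(** Take a maximal set G of choice functions on F that pairwise differ at every
member of F.  By maximality the values of G exhaust some member A of F, since
otherwise a function avoiding the values of G everywhere could be added; then
sending a to the value at B of the function of G that takes the value a at A
embeds A into B. *)
Lemma exists_least_card (F : set (set T)) : F !=set0 ->
  exists2 A, F A & forall B, F B -> A #<= B.
Proof.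
move=> [A0 FA0].
pose P (G : set (set T -> T)) :=
  (forall f, G f -> forall A, F A -> A (f A)) /\
  (forall f g, G f -> G g -> f <> g -> forall A, F A -> f A <> g A).
have [Fs FsP tot|G [[Gin Gdiff] Gmax]] := @Zorn_bigcup _ P.
  split=> [f [G FsG Gf]|f g [G FsG Gf] [H FsH Hg]]; first exact: (FsP G FsG).1.
  case: (tot _ _ FsG FsH) => sub.
    by apply: (FsP H FsH).2 => //; exact: sub.
  by apply: (FsP G FsG).2 => //; exact: sub.
have [A FA Asurj] : exists2 A, F A & forall a, A a -> exists2 f, G f & f A = a.
  apply: contrapT => noA.
  have /choice [h hP] : forall A, exists a,
      F A -> A a /\ forall f, G f -> f A <> a.
    move=> A; have [FA|nFA] := pselect (F A); last by exists point.
    apply: contrapT => noa; apply: noA; exists A => // a Aa.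
    apply: contrapT => nof; apply: noa; exists a => _; split=> // f Gf fAa.
    by apply: nof; exists f.
  have nGh : ~ G h by move=> Gh; exact: (hP A0 FA0).2 h Gh erefl.
  apply: (Gmax (G `|` [set h])).
    by split; [move=> f; left|move=> /(_ h (or_intror erefl))].
  split=> [f [Gf|->] A FA|f g [Gf|->] [Gg|->] fg A FA].
  - exact: (Gin _ Gf _ FA).
  - exact: (hP A FA).1.
  - exact: (Gdiff _ _ Gf Gg fg _ FA).
  - exact: ((hP A FA).2 _ Gf).
  - by move=> /esym; exact: ((hP A FA).2 _ Gg).
  - by [].
exists A => // B FB; apply/card_leEx.
have /choice [k kP] : forall a, exists f, A a -> G f /\ f A = a.
  move=> a; have [/Asurj [f Gf fa]|nAa] := pselect (A a); first by exists f.
  by exists (fun=> point).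
exists (fun a => k a B) => [a Aa|a b Aa Ab kab].
  exact: (Gin _ (kP a Aa).1 _ FB).
have [Ga <-] := kP a Aa; have [Gb <-] := kP b Ab.
have [->//|kk] := pselect (k a = k b).
by case: (Gdiff _ _ Ga Gb kk B FB).
Qed.

Lemma card_le_total A B : A #<= B \/ B #<= A.
Proof.
have [|C [->|->] le] := @exists_least_card [set A; B]; first by exists A; left.
  by left; apply: le; right.
by right; apply: le; left.
Qed.

Lemma infinite_set_neq A : infinite_set A -> exists a b, [/\ A a, A b & a <> b].
Proof.
move=> /infiniteP /card_leEx [f fA finj]; exists (f 0%N), (f 1%N).
split; [exact: fA|exact: fA|].
by move=> /(finj _ _ I I).
Qed.

(** Two disjoint copies of B fit into [B `*` B], as the pairs whose first
coordinate is b0 and those whose first coordinate is b1. *)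
Lemma card_leU B (U : Type) (A1 A2 : set U) : infinite_set B -> B `*` B #<= B ->
  A1 #<= B -> A2 #<= B -> A1 `|` A2 #<= B.
Proof.
move=> /infinite_set_neq [b0 [b1 [Bb0 Bb1 b01]]] /card_leEx [c cB cinj].
move=> /card_leEx [f fB finj] /card_leEx [g gB ginj]; apply/card_leEx.
exists (fun x => if x \in A1 then c (b0, f x) else c (b1, g x)) => [x|x y].
  case: ifPn => [/set_mem Ax _|/negP Ax [/mem_set//|Ax']]; apply: cB.
    by split=> //=; exact: fB.
  by split=> //=; exact: gB.
have cinj' x1 y1 x2 y2 : B x1 -> B y1 -> B x2 -> B y2 ->
    c (x1, y1) = c (x2, y2) -> x1 = x2 /\ y1 = y2.
  move=> Bx1 By1 Bx2 By2.
  by move=> /(cinj (_, _) (_, _) (conj Bx1 By1) (conj Bx2 By2)) [-> ->].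
have A2P u : (A1 `|` A2) u -> u \notin A1 -> A2 u.
  by move=> [/mem_set -> //|].
move=> A1x A1y.
case: ifPn => Ax; case: ifPn => Ay.
- move=> /cinj' [] //; try exact/fB/set_mem.
  by move=> _ /finj -> //; exact/set_mem.
- by move=> /cinj' [] //; [exact/fB/set_mem|exact/gB/A2P].
- by move=> /cinj' [] //; [exact/gB/A2P|exact/fB/set_mem|move=> /esym].
- move=> /cinj' [] //; try exact/gB/A2P.
  by move=> _ /ginj -> //; exact/A2P.
Qed.

(** Injections of [B `*` B] into B are encoded by their graphs, so that their
extension is inclusion and Zorn's lemma for sets applies; B is recovered from
the graph through the diagonal. *)
Let dom (G : set (T * T * T)) : set T := [set x | exists z, G (x, x, z)].

(** Either the empty graph, or the graph of an injection of [B `*` B] into B for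
an infinite subset B of A; the empty graph is there for empty chains. *)
Let pairing_graph A (G : set (T * T * T)) : Prop :=
  [/\ dom G `<=` A,
      forall x y z, G (x, y, z) -> [/\ dom G x, dom G y & dom G z],
      forall x y, dom G x -> dom G y -> exists z, G (x, y, z),
      forall p q z w, G (p, z) -> G (q, w) -> p = q <-> z = w &
      forall x, dom G x -> infinite_set (dom G)].

Let graph_on B (f : T * T -> T) : set (T * T * T) :=
  [set p | [/\ B p.1.1, B p.1.2 & p.2 = f p.1]].

Let dom_graph_on B f : dom (graph_on B f) = B.
Proof.
apply/seteqP; split=> [x [z [Bx _ _]]//|x Bx].
by exists (f (x, x)); split.
Qed.

Let pairing_graph_on A B f : B `<=` A -> infinite_set B ->
  (forall p, (B `*` B) p -> B (f p)) ->
  (forall p q, (B `*` B) p -> (B `*` B) q -> f p = f q -> p = q) ->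
  pairing_graph A (graph_on B f).
Proof.
move=> BA Binf fB finj; rewrite /pairing_graph dom_graph_on; split=> //.
- by move=> x y z [/= Bx By ->]; split=> //; apply: fB.
- by move=> x y Bx By; exists (f (x, y)); split.
- move=> p q z w [/= Bp1 Bp2 ->] [/= Bq1 Bq2 ->]; split=> [->//|].
  by apply: finj.
Qed.

Let pairing_graph_bigcup A (F : set (set (T * T * T))) :
  F `<=` pairing_graph A -> total_on F subset ->
  pairing_graph A (\bigcup_(G in F) G).
Proof.
move=> FP tot.
have domS G : F G -> dom G `<=` dom (\bigcup_(G in F) G).
  by move=> FG x [z Gz]; exists z, G.
have domE x : dom (\bigcup_(G in F) G) x -> exists2 G, F G & dom G x.
  by move=> [z [G FG Gz]]; exists G => //; exists z.
have common G H : F G -> F H -> exists K, [/\ F K, G `<=` K & H `<=` K].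
  by move=> FG FH; case: (tot _ _ FG FH) => ?; [exists H|exists G]; split.
split.
- by move=> x /domE [G FG]; case: (FP G FG) => GA _ _ _ _; exact: GA.
- move=> x y z [G FG]; case: (FP G FG) => _ Gd _ _ _ /Gd [dx dy dz].
  by split; exact: (domS G FG).
- move=> x y /domE [G FG [zx Gx]] /domE [H FH [zy Hy]].
  have [K [FK GK HK]] := common _ _ FG FH.
  have [_ _ Kt _ _] := FP K FK.
  have [||z Kz] := Kt x y; [by exists zx; exact: GK|by exists zy; exact: HK|].
  by exists z, K.
- move=> p q z w [G FG Gz] [H FH Hw].
  have [K [FK GK HK]] := common _ _ FG FH.
  have [_ _ _ Ki _] := FP K FK.
  by apply: Ki; [exact: GK|exact: HK].
- move=> x /domE [G FG]; case: (FP G FG) => _ _ _ _ Ginf /Ginf.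
  exact: sub_infinite_set (domS G FG).
Qed.

(** Hessenberg's theorem.  Let f be a maximal injection of [B `*` B] into B with
B an infinite subset of A.  If A outside B embeds into B, then A has the
cardinality of B.  Otherwise A contains a copy of B disjoint from B, into which
the pairs that are not in [B `*` B] can be injected, contradicting
maximality. *)
Lemma infinite_card_square A : infinite_set A -> A `*` A #<= A.
Proof.
move=> Ainf.
have [G [Gpair Gmax]] := Zorn_bigcup (@pairing_graph_bigcup A).
have [GA Gd Gt Gi Ginf] := Gpair.
have {}Gmax B f : dom G `<=` B -> (exists2 b, B b & ~ dom G b) ->
    (forall x y z, G (x, y, z) -> z = f (x, y)) ->
    B `<=` A -> infinite_set B ->
    (forall p, (B `*` B) p -> B (f p)) ->
    ~ (forall p q, (B `*` B) p -> (B `*` B) q -> f p = f q -> p = q).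
  move=> GB [b Bb Gb] Gf BA Binf fB finj.
  apply: (Gmax (graph_on B f)); last exact: pairing_graph_on.
  split=> [[[x y] z] Gxyz|sub].
    have [dx dy _] := Gd _ _ _ Gxyz.
    by split=> /=; [exact: GB|exact: GB|exact: Gf].
  by apply: Gb; exists (f (b, b)); apply: sub; split.
set B := dom G in GA Gd Gt Ginf Gmax *.
have [/set0P [x0 /Ginf Binf]|/negP] := boolP (B != set0); last first.
  move/negP; rewrite negbK => /eqP B0; exfalso.
  have /card_leEx [a aA ainj] := (infiniteP A).1 Ainf.
  (* The empty graph is not maximal: a countable subset carries a pairing. *)
  pose C := range a.
  have Cinf : infinite_set C.
    apply/infiniteP/card_leEx; exists a => // n _; exact: imageP.
  have : C `*` C #<= C.
    apply: (@card_le_trans _ _ _ [set: nat]); last exact/infiniteP.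
    by apply: countableX; apply: card_image_le.
  move=> /card_leEx [f fC finj]; apply: (Gmax C f) => //.
  - by rewrite B0.
  - by exists (a 0%N); [exact: imageP|rewrite B0].
  - by move=> x y z /Gd; rewrite B0 => -[].
  - by move=> _ [n _ <-]; exact: aA.
have /choice [f fG] : forall p : T * T, exists z, B p.1 -> B p.2 -> G (p, z).
  move=> [x y] /=; have [[Bx By]|nB] := pselect (B x /\ B y).
    by have [z Gz] := Gt x y Bx By; exists z.
  by exists point => Bx By; case: nB.
have fGE x y z : G (x, y, z) -> z = f (x, y).
  move=> Gz; have [Bx By _] := Gd _ _ _ Gz.
  exact/(Gi _ _ _ _ Gz (fG (x, y) Bx By)).
have fB x y : B x -> B y -> B (f (x, y)).
  by move=> Bx By; have [] := Gd _ _ _ (fG (x, y) Bx By).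
have finj x y x' y' : B x -> B y -> B x' -> B y' -> f (x, y) = f (x', y') ->
    x = x' /\ y = y'.
  move=> Bx By Bx' By' ff; have [_ /(_ ff) [-> ->]//] :=
    Gi _ _ _ _ (fG (x, y) Bx By) (fG (x', y') Bx' By').
have Bsq : B `*` B #<= B.
  apply/card_leEx; exists f => [[u v] []|]; first exact: fB.
  move=> [u v] [u' v'] [/= Bu Bv] [/= Bu' Bv'].
  by move=> /finj [] // -> ->.
have [DB|/card_leEx [g gD ginj]] := card_le_total (A `\` B) B.
  have AB : A #<= B.
    rewrite -(setDUK GA); exact: card_leU.
  apply: (@card_le_trans _ _ _ (B `*` B)); last first.
    by apply: card_le_trans Bsq _; exact: subset_card_le.
  move/card_leEx: AB => [h hB hinj]; apply/card_leEx.
  exists (fun p => (h p.1, h p.2)) => [[u v] [Au Av]|].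
    by split; exact: hB.
  move=> [u v] [u' v'] [/= Au Av] [/= Au' Av'] [].
  by move=> /hinj -> // /hinj -> //.
exfalso.
have [b0 [b1 [Bb0 Bb1 b01]]] := infinite_set_neq Binf.
pose C := B `|` g @` B.
(* k folds the copy g @` B back onto B; u is determined by k u and by the
   side on which it lies, which c records as an element of B. *)
have /choice [k kP] : forall u, exists b, C u ->
    B b /\ (if u \in B then b = u else g b = u).
  move=> u; have [[Bu|[b Bb gb]]|nCu] := pselect (C u); last by exists point.
    by exists u => _; rewrite (mem_set Bu).
  exists b => _; split=> //; case: ifPn => // /set_mem Bu.
  by have [_ []] := gD b Bb; rewrite gb.
have kB u : C u -> B (k u) by move=> /kP [].
have kinj u v : C u -> C v -> (u \in B) = (v \in B) -> k u = k v -> u = v.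
  move=> /kP [_ ku] /kP [_ kv] uv kuv; move: ku kv; rewrite uv kuv.
  by case: ifP => _ ku kv; exact: etrans (esym ku) kv.
pose c (u : T) := if u \in B then b1 else b0.
have cB u : B (c u) by rewrite /c; case: ifP.
have cinj u v : c u = c v -> (u \in B) = (v \in B).
  by rewrite /c; case: ifP; case: ifP => // _ _; move=> // /esym.
pose code u v := f (f (c u, c v), f (k u, k v)).
have codeB u v : C u -> C v -> B (code u v).
  by move=> /kB ? /kB ?; apply: (fB); apply: (fB).
have codeinj u v u' v' : C u -> C v -> C u' -> C v' -> code u v = code u' v' ->
    u = u' /\ v = v'.
  have inner w z : C w -> C z -> B (f (c w, c z)) /\ B (f (k w, k z)).
    by move=> /kB Bw /kB Bz; split; exact: fB.
  move=> Cu Cv Cu' Cv' code_eq.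
  have [Bc Bk] := inner u v Cu Cv; have [Bc' Bk'] := inner u' v' Cu' Cv'.
  have [ceq keq] := finj _ _ _ _ Bc Bk Bc' Bk' code_eq.
  have [/cinj cu /cinj cv] := finj _ _ _ _ (cB u) (cB v) (cB u') (cB v') ceq.
  have [ku kv] := finj _ _ _ _ (kB _ Cu) (kB _ Cv) (kB _ Cu') (kB _ Cv') keq.
  by split; exact: kinj.
pose F (p : T * T) :=
  if (p.1 \in B) && (p.2 \in B) then f p else g (code p.1 p.2).
apply: (Gmax C F).
- by move=> u; left.
- by exists (g b0); [right; exact: imageP|exact: (gD b0 Bb0).2].
- move=> u v z Gz; have [Bu Bv _] := Gd _ _ _ Gz.
  by rewrite /F /= !mem_set//= (fGE _ _ _ Gz).
- by move=> u [/GA //|[b Bb <-]]; exact: (gD b Bb).1.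
- by apply: sub_infinite_set Binf => u; left.
- move=> [u v] [Cu Cv]; rewrite /F /=.
  case: ifPn => [/andP [/set_mem Bu /set_mem Bv]|_].
    by left; exact: fB.
  by right; apply/imageP/codeB.
- move=> [u v] [u' v'] [/= Cu Cv] [/= Cu' Cv']; rewrite /F /=.
  case: ifPn => [/andP [/set_mem Bu /set_mem Bv]|_];
    case: ifPn => [/andP [/set_mem Bu' /set_mem Bv']|_].
  + by move=> /finj [] // -> ->.
  + move=> fg; have := (gD _ (codeB _ _ Cu' Cv')).2.
    by rewrite /= -fg; case; exact: fB.
  + move=> fg; have := (gD _ (codeB _ _ Cu Cv)).2.
    by rewrite /= fg; case; exact: fB.
  + move=> /(ginj _ _ (codeB _ _ Cu Cv) (codeB _ _ Cu' Cv')).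
    by move=> /codeinj [] // -> ->.
Qed.

(** The pairing of A codes a sequence by iteration; pairing the code with the
length of the sequence makes it injective on sequences of all lengths. *)
Lemma card_le_seq (K : countType) A : infinite_set A ->
  [set s : seq (K * T) | forall p, p \in s -> A p.2] #<= A.
Proof.
move=> Ainf; have /card_leEx [c cA cinj] := infinite_card_square Ainf.
have /card_leEx [a aA ainj] := (infiniteP A).1 Ainf.
have aA' n : A (a n) by exact: aA.
have cA' x y : A x -> A y -> A (c (x, y)) by move=> ? ?; exact: cA.
have cinj' x y x' y' : A x -> A y -> A x' -> A y' -> c (x, y) = c (x', y') ->
    x = x' /\ y = y'.
  move=> Bx1 By1 Bx2 By2.
  by move=> /(cinj (_, _) (_, _) (conj Bx1 By1) (conj Bx2 By2)) [-> ->].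
pose e := foldr (fun (p : K * T) y => c (c (a (pickle p.1), p.2), y)) (a 0%N).
have eA s : (forall p, p \in s -> A p.2) -> A (e s).
  elim: s => [|p s IH] sA //=; apply: (cA').
    by apply: (cA') => //; apply: sA; rewrite mem_head.
  by apply: IH => q qs; apply: sA; rewrite inE qs orbT.
apply/card_leEx; exists (fun s => c (a (size s), e s)) => [s sA|s t].
  by apply: (cA') => //; exact: eA.
move=> sA tA /cinj' [] //; try exact: eA.
move=> /(ainj _ _ I I).
elim: s t sA tA => [|[q x] s IH] [|[q' x'] t] //= sA tA [st].
have Ax : A x by exact: (sA (q, x) (mem_head _ _)).
have Ax' : A x' by exact: (tA (q', x') (mem_head _ _)).
have sA' p : p \in s -> A p.2 by move=> ps; apply: sA; rewrite inE ps orbT.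
have tA' p : p \in t -> A p.2 by move=> ps; apply: tA; rewrite inE ps orbT.
move=> /cinj' []; try exact: eA; try exact: cA'.
move=> /cinj' [] // /(ainj _ _ I I).
move=> /(pcan_inj pickleK) -> -> /(IH _ sA' tA' st) ->.
by [].
Qed.

Lemma card_lt_setU1 (U : Type) (kappa : set U) (K S A : set T) x :
  infinite_set K -> K #= kappa -> ~ (K #<= S) -> A #<= S ->
  card_lt (x |` A) kappa.
Proof.
move=> Kinf Kk KS AS.
have nK : ~ (K #<= x |` A).
  have [Sfin|Sinf] := pselect (finite_set S).
    move=> /card_le_finite Kfin; apply: Kinf; apply: Kfin.
    by rewrite finite_setU; split=> //; exact: card_le_finite AS Sfin.
  move=> Kle; apply: KS; apply: card_le_trans Kle _.
  apply: card_leU => //; first exact: infinite_card_square.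
  have [s [_ [Ss _ _]]] := infinite_set_neq Sinf.
  by apply/card_leEx; exists (fun=> s) => // y z -> ->.
have [//|Ale] := card_le_total K (x |` A).
rewrite /card_lt -(card_le_eqr Kk) -(card_eqr Kk); split=> //.
by rewrite card_eq_le => /andP [].
Qed.

End Cardinals.

(** * Well-orders of minimal length and transfinite choice *)

Section WellOrders.
Local Open Scope card_scope.

(** The well-ordering principle, in the form of a strict order that supports
well-founded recursion. *)
Lemma strict_well_order (T : eqType) : exists lt : T -> T -> Prop,
  [/\ well_founded lt, forall x y, lt x y \/ x = y \/ lt y x &
      forall x y z, lt x y -> lt y z -> lt x z].
Proof.
have [R wo] := well_ordering_principle T.
have least (P : T -> Prop) : (exists x, P x) ->
    exists2 x, P x & forall y, P y -> R x y.
  move=> [x Px].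
  have [|z [[zP zmin] _]] := wo [pred y | `[< P y >]].
    by exists x; rewrite inE.
  exists z; first by move: zP; rewrite inE.
  by move=> y Py; apply: zmin; rewrite inE.
have anti x y : R x y -> R y x -> x = y.
  move=> Rxy Ryx; have Rr z : R z z.
    by have [w -> wz] := least (eq z) (ex_intro _ z erefl); exact: wz.
  have [|z [_ uniqz]] := wo [pred w | (w == x) || (w == y)].
    by exists x; rewrite !inE eqxx.
  have /uniqz <- : minimum_of R [pred w | (w == x) || (w == y)] x.
    by split; [rewrite !inE eqxx|move=> w; rewrite !inE => /orP [] /eqP ->].
  apply: uniqz.
  by split; [rewrite !inE eqxx orbT|move=> w; rewrite !inE => /orP [] /eqP ->].
have total x y : R x y \/ R y x.
  have [z [->|->] zmin] :=
      least (fun w => w = x \/ w = y) (ex_intro _ x (or_introl erefl)).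
    by left; apply: zmin; right.
  by right; apply: zmin; left.
have trans x y z : R x y -> R y z -> R x z.
  move=> Rxy Ryz.
  have [w] := least (fun w => [\/ w = x, w = y | w = z])
    (ex_intro _ x (Or31 _ _ erefl)).
  move=> [->|->|->] wmin.
  - by apply: wmin; apply: Or33.
  - by rewrite (anti x y Rxy (wmin _ (Or31 _ _ erefl))).
  - by rewrite -(anti y z Ryz (wmin _ (Or32 _ _ erefl))).
exists (fun x y => R x y /\ x <> y); split.
- move=> x; apply: contrapT => nAcc.
  have [z nz zmin] := least (fun w => ~ Acc _ w) (ex_intro _ x nAcc).
  apply: nz; constructor => y [Ryz yz]; apply: contrapT => ny.
  by apply: yz; apply: anti => //; exact: zmin.
- move=> x y; have [->|xy] := pselect (x = y); first by right; left.
  by case: (total x y) => ?; [left|right; right; split=> // /esym].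
- move=> x y z [Rxy xy] [Ryz yz]; split; first exact: trans Ryz.
  by move=> xz; apply: xy; apply: anti => //; rewrite xz.
Qed.

(** The analogue of the initial ordinal of A: if some proper initial segment of
a well-order of A is as large as A, the least such segment is used instead of
A as the set of indices. *)
Lemma initial_well_order (T : eqType) (A : set T) :
  exists (lt : T -> T -> Prop) (I : set T),
  [/\ well_founded lt, forall x y, lt x y \/ x = y \/ lt y x,
      forall x y z, lt x y -> lt y z -> lt x z, I #= A &
      forall i, I i -> ~ (A #<= [set j | I j /\ lt j i])].
Proof.
have [lt [wf total trans]] := strict_well_order T; exists lt.
have [[i0 [Ai0 i0P]]|noi] :=
  pselect (exists i, A i /\ A #<= [set j | A j /\ lt j i]); last first.
  exists A; split=> // i Ai Ale.
  by apply: noi; exists i.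
have {i0 Ai0 i0P} [i [Ai iP imin]] : exists i,
  [/\ A i, A #<= [set j | A j /\ lt j i] &
    forall j, A j -> lt j i -> ~ (A #<= [set k | A k /\ lt k j])].
  move: Ai0 i0P; elim/(well_founded_ind wf): i0 => i IH Ai iP.
  have [[j [Aj ji jP]]|noj] :=
    pselect (exists j, [/\ A j, lt j i & A #<= [set k | A k /\ lt k j]]).
    exact: IH j ji Aj jP.
  by exists i; split=> // j Aj ji jP; apply: noj; exists j.
exists [set j | A j /\ lt j i]; split=> //.
  by rewrite card_eq_le iP andbT; apply: subset_card_le => j [].
move=> j [Aj ji] Ale; apply: (imin j Aj ji); apply: card_le_trans Ale _.
by apply: subset_card_le => k [[Ak _] kj].
Qed.

(** Only sets B no larger than the segment below i matter, because the values
chosen below i form such a set; the size bound is what makes the choice at i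
possible. *)
Lemma well_founded_choice (T : Type) (Y : pointedType) (lt : T -> T -> Prop)
    (I : set T) (good : T -> set Y -> Y -> Prop) : well_founded lt ->
  (forall i, I i -> forall B : set Y, B #<= [set j | I j /\ lt j i] ->
     exists y, good i B y) ->
  exists p : T -> Y, forall i, I i ->
    good i (p @` [set j | I j /\ lt j i]) (p i).
Proof.
move=> wf ex_good.
have /choice [g gP] : forall iB : T * set Y, exists y, I iB.1 ->
    iB.2 #<= [set j | I j /\ lt j iB.1] -> good iB.1 iB.2 y.
  move=> [i B] /=.
  have [[Ii Ble]|nIB] := pselect (I i /\ B #<= [set j | I j /\ lt j i]).
    by have [y gy] := ex_good i Ii B Ble; exists y.
  by exists point => Ii Ble; case: nIB.
pose step i (rec : forall j, lt j i -> Y) :=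
  g (i, [set y | exists j (h : lt j i), I j /\ y = rec j h]).
exists (Fix wf (fun=> Y) step) => i Ii.
have -> : Fix wf (fun=> Y) step i =
    g (i, Fix wf (fun=> Y) step @` [set j | I j /\ lt j i]).
  rewrite Fix_eq => [|j u v uv].
    rewrite /step; congr (g (i, _)); apply/seteqP; split=> y.
      by move=> [j [h [Ij ->]]]; exists j.
    by move=> [j [Ij h] <-]; exists j, h.
  rewrite /step; congr (g (j, _)); apply/seteqP; split=> y [k [h [Ik ->]]];
    by exists k, h; rewrite uv.
by apply: (gP (_, _)) => //; exact: card_image_le.
Qed.

End WellOrders.

(** * Linear spans and generated subgroups *)

Section NormedSpaces.
Context {R : realType} {X : normedModType R}.
Implicit Types (A D P Q S Z : set X) (u v x y z : X) (a r theta : R).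

Lemma linear_subspaceP Z : linear_subspace Z <->
  Z 0 /\ forall a u v, Z u -> Z v -> Z (a *: u + v).
Proof.
split=> [[/set_mem Z0 ZD]|[Z0 ZD]].
  by split=> // a u v Zu Zv; apply: set_mem; apply: ZD; exact: mem_set.
by split=> [|a u v /set_mem Zu /set_mem Zv]; apply: mem_set; [|exact: ZD].
Qed.

Lemma additive_subgroupP P : additive_subgroup P <->
  P 0 /\ forall u v, P u -> P v -> P (u - v).
Proof.
split=> [[/set_mem P0 PB]|[P0 PB]].
  by split=> // u v Pu Pv; apply: set_mem; apply: PB; exact: mem_set.
by split=> [|u v /set_mem Pu /set_mem Pv]; apply: mem_set; [|exact: PB].
Qed.

Lemma linear_span_subspace D : linear_subspace (linear_span D).
Proof.
apply/linear_subspaceP; split=> [Z [/linear_subspaceP [] //]|a u v Du Dv Z ZD].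
have /linear_subspaceP [_ ZL] := ZD.1.
by apply: ZL; [exact: Du|exact: Dv].
Qed.

Lemma subspaceZ Z a u : linear_subspace Z -> Z u -> Z (a *: u).
Proof.
by move=> /linear_subspaceP [Z0 ZL] Zu; rewrite -[_ *: _]addr0; exact: ZL.
Qed.

Lemma subspaceD Z u v : linear_subspace Z -> Z u -> Z v -> Z (u + v).
Proof.
by move=> /linear_subspaceP [Z0 ZL] Zu Zv; rewrite -[u]scale1r; exact: ZL.
Qed.

Definition subgroup_span A : set X := smallest additive_subgroup A.

Lemma subgroup_span_subgroup A : additive_subgroup (subgroup_span A).
Proof.
apply/additive_subgroupP; split=> [P [/additive_subgroupP [] //]|].
move=> u v Au Av P PA.
have /additive_subgroupP [_ PB] := PA.1.
by apply: PB; [exact: Au|exact: Av].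
Qed.

Lemma subgroupMz P x (n : int) : additive_subgroup P -> P x -> P (x *~ n).
Proof.
move=> /additive_subgroupP [P0 PB] Px.
have PN u : P u -> P (- u) by move=> Pu; rewrite -sub0r; exact: PB.
have Pn (m : nat) : P (x *+ m).
  elim: m => // m IH; rewrite mulrSr -[x in _ + x]opprK.
  by apply: PB => //; exact: PN.
by case: n => m; [exact: Pn|apply: PN; exact: Pn].
Qed.

Lemma subgroup_span_setU1 A p w : subgroup_span (A `|` [set p]) w ->
  exists q (n : int), subgroup_span A q /\ w = q + p *~ n.
Proof.
have Asub := subgroup_span_subgroup A.
move=> /(_ [set w | exists q (n : int), subgroup_span A q /\ w = q + p *~ n]).
apply.
split=> [|x [Ax|->]]; last 2 first.
- by exists x, 0; split; [exact: sub_gen_smallest|rewrite mulr0z addr0].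
- exists 0, 1; split; last by rewrite add0r.
  by have /additive_subgroupP [] := Asub.
apply/additive_subgroupP; split=> [|u v [q [n [Aq ->]]] [q' [n' [Aq' ->]]]].
  exists 0, 0; split; last by rewrite mulr0z addr0.
  by have /additive_subgroupP [] := Asub.
exists (q - q'), (n - n'); split; last by rewrite mulrzBr opprD addrACA.
by have /additive_subgroupP [_] := Asub; apply.
Qed.

(** * Density *)

(** The density of the span is the cardinality of a smallest set spanning it
densely, and S is one of the competitors. *)
Lemma density_lt_linear_span (U : Type) (kappa : set U) S :
  card_lt S kappa -> density_lt (linear_span S) kappa.
Proof.
move=> [Sle Sne].
have [|D SD Dmin] := @exists_least_card X (spans_densely (linear_span S)).
  by exists S; split; [exact: sub_gen_smallest|exact: subset_closure].
exists D; first by split=> //; exists D => //; exact: card_eqxx.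
have DS : (D #<= S)%card.
  by apply: Dmin; split; [exact: sub_gen_smallest|exact: subset_closure].
split; first exact: card_le_trans DS Sle.
move=> Deq; apply: Sne; rewrite card_eq_le Sle /=.
by move: Deq; rewrite card_eq_le => /andP [_ kD]; exact: card_le_trans kD DS.
Qed.

Lemma closureP A x :
  closure A x <-> forall e, 0 < e -> exists2 y, A y & `|x - y| < e.
Proof.
split=> [Ax e e0|Ae B /nbhs_ballP [e e0 eB]].
  have [y [Ay]] := Ax _ (nbhsx_ballx x e e0).
  by rewrite -ball_normE /= => xy; exists y.
have [y Ay xy] := Ae e e0; exists y; split=> //.
by apply: eB; rewrite -ball_normE.
Qed.

Lemma linear_span_setU1 S v w : linear_span (v |` S) w ->
  exists a f, linear_span S f /\ w = a *: v + f.
Proof.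
have Ssub := linear_span_subspace S.
have [S0 SL] := (linear_subspaceP _).1 Ssub.
move=> /(_ [set w | exists a f, linear_span S f /\ w = a *: v + f]); apply.
split=> [|x [->|Sx]]; last 2 first.
- by exists 1, 0; rewrite scale1r addr0.
- by exists 0, x; rewrite scale0r add0r; split=> //; exact: sub_gen_smallest.
apply/linear_subspaceP; split=> [|b u u' [a [f [Sf ->]]] [a' [f' [Sf' ->]]]].
  by exists 0, 0; rewrite scale0r addr0.
exists (b * a + a'), (b *: f + f'); split; first exact: SL.
by rewrite scalerDr scalerDl scalerA addrACA.
Qed.

(** Adding a line to a closed subspace F keeps it closed.  If v is outside F,
then |a v + f| >= d |a| for some d > 0, so that the coefficients a of better
and better approximations a v + f of x converge to some s, and x - s v is a
limit of elements of F. *)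
Lemma closed_linear_span_setU1 S v :
  closed (linear_span S) -> closed (linear_span (v |` S)).
Proof.
set F := linear_span S => Fcl x /closureP xF.
have Fsub : linear_subspace F := linear_span_subspace S.
have [F0 FL] := (linear_subspaceP F).1 Fsub.
have FsubU : F `<=` linear_span (v |` S).
  apply: smallest_sub; first exact: linear_span_subspace.
  by move=> y Sy; apply: sub_gen_smallest; right.
have vU : linear_span (v |` S) v by apply: sub_gen_smallest; left.
have Usub := linear_span_subspace (v |` S).
have [Fv|nFv] := pselect (F v).
  apply: FsubU; apply: Fcl; apply/closureP => e /xF [y Uy xy]; exists y => //.
  by have [a [f [Ff ->]]] := linear_span_setU1 Uy; exact: FL.
have [d d0 dP] : exists2 d, 0 < d &
    forall a f, F f -> d * `|a| <= `|a *: v + f|.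
  have : ~ closure F v by move/Fcl.
  move=> /closureP/existsNP [d /not_implyP [d0 /forall2NP dP]]; exists d => //.
  move=> a f Ff; have [->|a0] := eqVneq a 0; first by rewrite normr0 mulr0.
  have [nF|/negP] := dP (- (a^-1 *: f)).
    by case: nF; rewrite -scaleNr; exact: (subspaceZ _ Fsub Ff).
  rewrite opprK -leNgt => dle.
  have -> : a *: v + f = a *: (v + a^-1 *: f).
    by rewrite scalerDr scalerA divff// scale1r.
  by rewrite normrZ mulrC ler_pM2l ?normr_gt0.
(* (a, e) is in E when some a *: v + f approximates x with error below e; then
   the limit coefficient lies in the interval of radius e / d around a, and it
   is obtained as the supremum of the left ends of these intervals. *)
pose E := [set p : R * R |
  0 < p.2 /\ exists2 f, F f & `|x - (p.1 *: v + f)| < p.2].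
have Eex e : 0 < e -> exists a, E (a, e).
  move=> e0; have [y Uy xy] := xF e e0.
  have [a [f [Ff yE]]] := linear_span_setU1 Uy.
  by exists a; split=> //; exists f => //; rewrite -yE.
have Ecmp (p q : R * R) : E p -> E q -> p.1 - p.2 / d <= q.1 + q.2 / d.
  move=> [p0 [f Ff pf]] [q0 [g Fg qg]].
  rewrite lerBlDr -addrA -lerBlDl -mulrDl ler_pdivlMr//.
  apply: (@le_trans _ _ (d * `|p.1 - q.1|)).
    by rewrite mulrC ler_pM2l// ler_norm.
  apply: le_trans (dP (p.1 - q.1) (f - g) _) _.
    by rewrite addrC -scaleN1r; exact: FL.
  have -> : (p.1 - q.1) *: v + (f - g) =
      (x - (q.1 *: v + g)) - (x - (p.1 *: v + f)).
    by rewrite opprB [RHS]addrC subrKA opprD addrACA -scaleNr -scalerDl.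
  by rewrite (le_trans (ler_normB _ _))// ltW// ltrD.
pose L := [set p.1 - p.2 / d | p in E].
pose s := sup L.
have [a1 Ea1] := Eex 1 ltr01.
have Lsup : has_sup L.
  split; first by exists (a1 - 1 / d), (a1, 1).
  by exists (a1 + 1 / d) => _ [p Ep <-]; exact: (Ecmp _ (a1, 1)).
have sP (p : R * R) : E p -> `|p.1 - s| <= p.2 / d.
  move=> Ep; rewrite ler_distlC; apply/andP; split.
    by apply: sup_upper_bound => //; exists p.
  by apply: ge_sup => [|_ [q Eq <-]]; [exact: Lsup.1|exact: Ecmp].
have Fxs : F (x - s *: v).
  apply: Fcl; apply/closureP => e e0.
  pose c := 1 + `|v| / d.
  have c0 : 0 < c by rewrite /c ltr_pwDl// divr_ge0// ltW.
  have [a Ea] := Eex (e / c) (divr_gt0 e0 c0).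
  have [_ [f Ff /= xf]] := Ea.
  exists f => //.
  have -> : x - s *: v - f = (x - (a *: v + f)) + (a - s) *: v.
    by rewrite scalerBl opprD [- (_ *: _) - f]addrC !addrA subrK addrAC.
  apply: le_lt_trans (ler_normD _ _) _.
  have -> : e = e / c + e / c / d * `|v|.
    by rewrite -mulrA -[X in X + _]mulr1 -mulrDr [_^-1 * _]mulrC divfK ?gt_eqF.
  rewrite ltr_leD// normrZ; apply: ler_wpM2r => //.
  exact: (sP _ Ea).
have -> : x = s *: v + (x - s *: v) by rewrite addrC subrK.
exact: (subspaceD Usub (subspaceZ _ Usub vU) (FsubU _ Fxs)).
Qed.

Lemma closed_finite_linear_span S : finite_set S -> closed (linear_span S).
Proof.
move=> /finite_seqP [s ->] {S}; elim: s => [|v s IH]; last first.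
  have -> : [set` v :: s] = v |` [set` s].
    apply/seteqP; split=> x /=.
      by rewrite inE => /orP [/eqP|]; [left|right].
    by rewrite inE => -[->|->]; rewrite ?eqxx ?orbT.
  exact: closed_linear_span_setU1.
have span0 y : linear_span [set` [::]] y -> y = 0.
  move=> /(_ [set 0]) y0; apply: y0; split=> //; apply/linear_subspaceP.
  by split=> // a u v -> ->; rewrite scaler0 addr0.
move=> x /closureP x0; suff -> : x = 0.
  by have [] := (linear_subspaceP _).1 (linear_span_subspace [set` [::]]).
apply/eqP; rewrite -normr_le0; apply/ler_addgt0Pr => e /x0 [y /span0 ->].
by rewrite subr0 add0r => /ltW.
Qed.

(** The span of a finite D would be closed as well as dense, hence full. *)
Lemma infinite_spanning_set D : infinite_dimensional X ->
  spans_densely [set: X] D -> infinite_set D.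
Proof.
move=> infX [_ Ddense] Dfin; apply: infX; exists D => //.
apply/seteqP; split=> // x _; apply: (closed_finite_linear_span Dfin).
exact: Ddense.
Qed.

(** Take for E the rational linear combinations of D; they are coded by finite
sequences over D with rational labels, so D bounds their number. *)
Lemma exists_dense_of_span D : infinite_set D -> spans_densely [set: X] D ->
  exists2 E, (E #<= D)%card & closure E = [set: X].
Proof.
move=> Dinf [_ Ddense].
pose lin (s : seq (rat * X)) : X := \sum_(p <- s) ratr p.1 *: p.2.
pose DS := [set s : seq (rat * X) | forall p : rat * X, p \in s -> D p.2].
exists (lin @` DS).
  exact: card_le_trans (card_image_le lin DS) (card_le_seq _ Dinf).
set E := lin @` DS.
have E0 : E 0 by exists [::] => //; rewrite /lin big_nil.
have ED y z : E y -> E z -> E (y + z).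
  move=> [s sD <-] [t tD <-]; exists (s ++ t); last by rewrite /lin big_cat.
  by move=> p; rewrite mem_cat => /orP [/sD|/tD].
have EZ (q : rat) y : E y -> E (ratr q *: y).
  move=> [s sD <-]; exists [seq (q * p.1, p.2) | p <- s].
    by move=> _ /mapP [p ps ->]; exact: (sD p ps).
  rewrite /lin big_map scaler_sumr; apply: eq_bigr => p _ /=.
  by rewrite rmorphM scalerA.
have DE x : D x -> E x.
  move=> Dx; exists [:: (1, x)]; last by rewrite /lin big_seq1 rmorph1 scale1r.
  by move=> p; rewrite inE => /eqP ->.
have clD u v : closure E u -> closure E v -> closure E (u + v).
  move=> /closureP uE /closureP vE; apply/closureP => e e0.
  have e20 : 0 < e / 2 by rewrite divr_gt0.
  have [y Ey uy] := uE _ e20; have [z Ez vz] := vE _ e20.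
  exists (y + z); first exact: ED.
  by rewrite opprD addrACA (le_lt_trans (ler_normD _ _))// [e]splitr ltrD.
have clZ a u : closure E u -> closure E (a *: u).
  move=> /closureP uE; apply/closureP => e e0.
  have e20 : 0 < e / 2 by rewrite divr_gt0.
  have pos (t : R) : 0 < `|t| + 1 by rewrite ltr_wpDl.
  have posu : 0 < `|u| + 1 by rewrite ltr_wpDl.
  have [q] : exists q, ratr q \in `]a, (a + e / 2 / (`|u| + 1))[.
    by apply: rat_in_itvoo; rewrite ltrDl divr_gt0.
  rewrite in_itv /= => /andP [aq qa].
  have [y Ey uy] := uE (e / 2 / (`|ratr q : R| + 1)) (divr_gt0 e20 (pos _)).
  exists (ratr q *: y); first exact: EZ.
  have -> : a *: u - ratr q *: y = (a - ratr q) *: u + ratr q *: (u - y).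
    by rewrite scalerBl scalerBr addrA subrK.
  rewrite (le_lt_trans (ler_normD _ _))// [e]splitr ltrD// normrZ.
    apply: (@le_lt_trans _ _ (`|a - ratr q| * (`|u| + 1))).
      by rewrite ler_wpM2l// lerDl.
    by rewrite -ltr_pdivlMr// ltr0_norm ?subr_lt0// opprB ltrBlDl.
  apply: (@le_lt_trans _ _ ((`|ratr q : R| + 1) * `|u - y|)).
    by rewrite ler_wpM2r// lerDl.
  by rewrite mulrC -ltr_pdivlMr.
have clsub : linear_subspace (closure E).
  apply/linear_subspaceP; split=> [|a u v Eu Ev]; first exact: subset_closure.
  by apply: clD => //; exact: clZ.
have spanE : linear_span D `<=` closure E.
  by apply: smallest_sub => // x /DE; exact: subset_closure.
apply/seteqP; split=> // x _.
exact: (closed_closure (closureS spanE (Ddense x I))).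
Qed.

Lemma separated_subgroupP P r : additive_subgroup P ->
  separated_set r P <-> forall p, P p -> p <> 0 -> r <= `|p|.
Proof.
move=> /additive_subgroupP [P0 PB]; split=> [sepP p Pp p0|sepP x y Px Py xy].
  by rewrite -[p]subr0; exact: sepP.
by apply: sepP; [exact: PB|move/eqP; rewrite subr_eq0 => /eqP].
Qed.

(** * A unit vector far from the unit sphere of a subspace *)

Section UnitFarFromSphere.
Context (Z : set X) (u : X) (theta : R).
Context (Zsub : linear_subspace Z) (u1 : `|u| = 1) (theta1 : 1 < theta).
Context (far : (theta%:E <= dist_set u (unit_sphere Z))%E).

Let norm_addr_normalized z : Z z -> z != 0 -> theta <= `|u + `|z|^-1 *: z|.
Proof.
move=> Zz z0; have /ereal_infP far_le := far.
rewrite -lee_fin; apply: far_le.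
exists (- (`|z|^-1 *: z)); last by rewrite opprK.
split; first by rewrite -scaleNr; exact: subspaceZ Zsub Zz.
by rewrite normrN normrZ ger0_norm ?invr_ge0// mulVf// normr_eq0.
Qed.

(** With v = z / |z| and t = |z|, the vector t (u + v) equals
(u + z) + (t - 1) u, hence |u + z| >= t theta - (t - 1) >= theta. *)
Lemma norm_addr_far z : Z z -> 1 <= `|z| -> theta <= `|u + z|.
Proof.
move=> Zz z1; have z0 : 0 < `|z| by exact: lt_le_trans z1.
have zn0 : z != 0 by rewrite -normr_gt0.
have unit_far := norm_addr_normalized Zz zn0.
have : `|z| * `|u + `|z|^-1 *: z| <= `|u + z| + (`|z| - 1).
  rewrite -[X in X * _]normr_id -normrZ scalerDr scalerA.
  rewrite divff ?gt_eqF// scale1r.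
  have -> : `|z| *: u + z = (u + z) + (`|z| - 1) *: u.
    by rewrite scalerBl scale1r [RHS]addrC addrA subrK.
  rewrite (le_trans (ler_normD _ _))// normrZ u1 mulr1.
  by rewrite [X in _ + X]ger0_norm// subr_ge0.
have := ler_wpM2l (ltW z0) unit_far.
have : 0 <= (`|z| - 1) * (theta - 1) by rewrite mulr_ge0// subr_ge0// ltW.
by lra.
Qed.

(** When t = |z| < 1, normalizing z moves it by 1 - t, so
|u + z| >= theta - (1 - t), while |u + z| >= 1 - t; the average of the two
bounds is theta / 2.  When z = 0 the claim is theta <= 2, which requires the
unit sphere of Z to be nonempty. *)
Lemma norm_addr_half z :
  (exists2 w, Z w & w != 0) -> Z z -> theta / 2 <= `|u + z|.
Proof.
move=> [w Zw w0] Zz; have [->|z0] := eqVneq z 0.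
  have := norm_addr_normalized Zw w0.
  have : `|u + `|w|^-1 *: w| <= 1 + 1.
    rewrite (le_trans (ler_normD _ _))// u1 normrZ ger0_norm ?invr_ge0//.
    by rewrite mulVf// normr_eq0.
  by rewrite addr0 u1; lra.
have [z1|z1] := leP 1 `|z|.
  by move: theta1 (norm_addr_far Zz z1); lra.
have unit_far := norm_addr_normalized Zz z0.
have zp : 0 < `|z| by rewrite normr_gt0.
have : `|u + `|z|^-1 *: z| <= `|u + z| + (1 - `|z|).
  have -> : u + `|z|^-1 *: z = (u + z) + (`|z|^-1 - 1) *: z.
    by rewrite scalerBl scale1r addrACA subrr addr0.
  rewrite (le_trans (ler_normD _ _))// normrZ ger0_norm.
    by rewrite mulrBl mul1r mulVf ?gt_eqF.
  by rewrite subr_ge0 invf_ge1// ltW.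
have : 1 <= `|u + z| + `|z|.
  by rewrite -u1 -[X in `|X| <= _](addrK z); exact: ler_normB.
by lra.
Qed.

End UnitFarFromSphere.

(** The heart of the construction: x + (2 / theta) u can be added to the
generators when u is far from the unit sphere of a subspace containing the
group and x, and the group misses the ball of radius 2 / theta around x.
The latter forces x != 0, so Z is not trivial. *)
Lemma separated_setU1 A Z x u theta :
  linear_subspace Z -> A `<=` Z -> Z x -> `|u| = 1 -> 1 < theta ->
  (theta%:E <= dist_set u (unit_sphere Z))%E ->
  (forall q, subgroup_span A q -> 2 / theta < `|x - q|) ->
  separated_set 2 (subgroup_span A) ->
  separated_set 2 (subgroup_span (A `|` [set x + (2 / theta) *: u])).
Proof.
move=> Zsub AZ Zx u1 theta1 far xfar.
have Asub := subgroup_span_subgroup A.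
have [A0 AB] := (additive_subgroupP _).1 Asub.
move=> /(separated_subgroupP _ Asub) sepA.
apply/(separated_subgroupP _ (subgroup_span_subgroup _)) => w.
move=> /subgroup_span_setU1 [q [n [Aq ->]]] {w}.
have [->|n0] := eqVneq n 0; first by rewrite mulr0z addr0; exact: sepA.
move=> _.
set r := 2 / theta in xfar *.
have theta0 : 0 < theta by exact: lt_trans theta1.
have r0 : 0 < r by rewrite divr_gt0.
have rtheta : r * theta = 2 by rewrite divfK ?gt_eqF.
have ZA : subgroup_span A `<=` Z.
  apply: smallest_sub => //; apply/additive_subgroupP.
  split=> [|v v' Zv Zv']; first exact: ((linear_subspaceP _).1 Zsub).1.
  apply: (subspaceD Zsub) => //; rewrite -scaleN1r.
  exact: subspaceZ Zsub Zv'.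
have xn0 : x != 0.
  by have := lt_trans r0 (xfar 0 A0); rewrite subr0 normr_gt0.
pose a : R := n%:~R.
have a0 : a != 0 by rewrite intr_eq0.
have ar0 : a * r != 0 by apply: mulf_neq0 => //; rewrite gt_eqF.
pose z := (a * r)^-1 *: (q + a *: x).
have Zz : Z z.
  apply: (subspaceZ _ Zsub); apply: (subspaceD Zsub); first exact: ZA.
  exact: subspaceZ.
have -> : q + (x + r *: u) *~ n = (a * r) *: (u + z).
  rewrite scalerDr scalerA divff// scale1r.
  by rewrite -scaler_int scalerDr scalerA addrA [RHS]addrC.
rewrite normrZ normrM [X in _ * X * _]gtr0_norm//.
have [n2|n1] := leP 2 `|n|.
  have a2 : 2 <= `|a| by rewrite -intr_norm (ler_int R 2).
  have half : theta / 2 <= `|u + z|.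
    by apply: (norm_addr_half Zsub u1 theta1 far) => //; exists x.
  have : 2 * r * (theta / 2) <= `|a| * r * `|u + z|.
    apply: ler_pM => //; [by rewrite mulr_ge0// ltW|by rewrite divr_ge0// ltW|].
    by rewrite ler_pM2r.
  by move: rtheta; lra.
have aa : a = 1 \/ a = -1.
  by move: n0 n1; rewrite /a; case: (n) => [[|[|m]]|[|m]]//; [left|right].
have an : `|a| = 1 by case: aa => ->; rewrite ?normrN normr1.
have z1 : 1 <= `|z|.
  rewrite normrZ normfV normrM an mul1r gtr0_norm// mulrC ler_pdivlMr// mul1r.
  have -> : `|q + a *: x| = `|x - q *~ (- n)|.
    rewrite mulrNz opprK -scaler_int -/a.
    case: aa => ->; first by rewrite !scale1r addrC.
    by rewrite !scaleN1r -normrN opprB addrC.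
  by rewrite ltW// xfar//; exact: (subgroupMz _ Asub Aq).
have far_z : theta <= `|u + z| by exact: (norm_addr_far Zsub u1 theta1 far).
by rewrite an mul1r -rtheta ler_wpM2l// ltW.
Qed.

(** * The transfinite construction *)

Lemma separated_subset P Q r :
  P `<=` Q -> separated_set r Q -> separated_set r P.
Proof. by move=> PQ sepQ x y /PQ Qx /PQ Qy; exact: sepQ. Qed.

Lemma subgroup_spanS A B : A `<=` B -> subgroup_span A `<=` subgroup_span B.
Proof. exact: sub_smallest2r (subgroup_span_subgroup B). Qed.

Lemma separated_subgroup_span_chain (T : Type) (S : set T) (F : T -> set X) r :
  (forall i j, S i -> S j -> F i `<=` F j \/ F j `<=` F i) ->
  (forall i, S i -> separated_set r (subgroup_span (F i))) ->
  separated_set r (subgroup_span (\bigcup_(i in S) F i)).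
Proof.
move=> chain sepF.
pose V := [set w | w = 0 \/ exists2 i, S i & subgroup_span (F i) w].
have VB u v : V u -> V v -> V (u - v).
  have spanB i : forall x y, subgroup_span (F i) x -> subgroup_span (F i) y ->
      subgroup_span (F i) (x - y).
    by have /additive_subgroupP [] := subgroup_span_subgroup (F i).
  have span0 i : subgroup_span (F i) 0.
    by have /additive_subgroupP [] := subgroup_span_subgroup (F i).
  move=> [->|[i Si iu]] [->|[j Sj jv]].
  - by left; rewrite subr0.
  - by right; exists j => //; exact: spanB.
  - by right; exists i => //; exact: spanB.
  - case: (chain i j Si Sj) => /subgroup_spanS sub; right.
      by exists j => //; apply: spanB => //; exact: sub.
    by exists i => //; apply: spanB => //; exact: sub.
have FV : subgroup_span (\bigcup_(i in S) F i) `<=` V.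
  apply: smallest_sub; first by apply/additive_subgroupP; split=> //; left.
  by move=> x [i Si Fx]; right; exists i => //; exact: sub_gen_smallest.
apply/(separated_subgroupP _ (subgroup_span_subgroup _)) => w /FV [->//|[i Si]].
exact: ((separated_subgroupP _ (subgroup_span_subgroup _)).1 (sepF i Si)).
Qed.

(** A successor step that preserves separation suffices: below i the generated
group is the union of the groups generated up to each j below i. *)
Lemma separated_subgroup_span_image (T : Type) (lt : T -> T -> Prop) (I : set T)
    (p : T -> X) r :
  well_founded lt -> (forall i j, lt i j \/ i = j \/ lt j i) ->
  (forall i j k, lt i j -> lt j k -> lt i k) ->
  (forall i, I i ->
     separated_set r (subgroup_span (p @` [set j | I j /\ lt j i])) ->
     separated_set r
       (subgroup_span (p @` [set j | I j /\ lt j i] `|` [set p i]))) ->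
  separated_set r (subgroup_span (p @` I)).
Proof.
move=> wf total trans step.
pose L i := p @` [set j | I j /\ lt j i] `|` [set p i].
have Lmono i j : I i -> lt i j -> L i `<=` L j.
  move=> Ii ij x [[k [Ik ki] <-]|->]; left; last by exists i.
  by exists k => //; split=> //; exact: trans ij.
have sep_union (S : set T) : S `<=` I ->
    (forall i, S i -> separated_set r (subgroup_span (L i))) ->
    separated_set r (subgroup_span (p @` S)).
  move=> SI sepL.
  apply: (@separated_subset _ (subgroup_span (\bigcup_(i in S) L i))).
    by apply: subgroup_spanS => _ [i Si <-]; exists i => //; right.
  apply: separated_subgroup_span_chain => // i j Si Sj.
  case: (total i j) => [ij|[->|ji]].
  - by left; apply: Lmono => //; exact: SI.
  - by left.
  - by right; apply: Lmono => //; exact: SI.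
apply: (sep_union) => // i; elim/(well_founded_ind wf): i => i IH Ii.
by apply: step => //; apply: sep_union => [j []//|j [Ij ji]]; exact: IH.
Qed.

(** What the generator p chosen for x must achieve, A being the set of the
generators chosen before. *)
Definition good_extension r x A p : Prop :=
  (exists2 q, subgroup_span (A `|` [set p]) q & `|x - q| <= r) /\
  (separated_set 2 (subgroup_span A) ->
   separated_set 2 (subgroup_span (A `|` [set p]))).

(** If the group already comes within 2 / theta of x, then p = 0 adds
nothing. *)
Lemma exists_good_extension (U : Type) (kappa : set U) theta A x :
  1 < theta ->
  (forall Z : set X, linear_subspace Z -> density_lt Z kappa ->
     exists2 u : X, unit_sphere [set: X] u &
       (theta%:E <= dist_set u (unit_sphere Z))%E) ->
  card_lt (x |` A) kappa -> exists p, good_extension (2 / theta) x A p.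
Proof.
move=> theta1 far Alt.
have [[q Aq xq]|nq] :=
  pselect (exists2 q, subgroup_span A q & `|x - q| <= 2 / theta).
  exists 0; split; first by exists q => //; apply: subgroup_spanS Aq => y; left.
  apply: separated_subset => w /subgroup_span_setU1 [q' [n [Aq' ->]]].
  by rewrite mul0rz addr0.
have [u [_ u1] ufar] :=
  far _ (linear_span_subspace _) (density_lt_linear_span Alt).
have theta0 : 0 < theta by exact: lt_trans theta1.
exists (x + (2 / theta) *: u); split.
  exists (x + (2 / theta) *: u); first by apply: sub_gen_smallest; right.
  rewrite opprD addrA subrr add0r normrN normrZ u1 mulr1.
  by rewrite ger0_norm// divr_ge0// ltW.
apply: (separated_setU1 (linear_span_subspace _) _ _ u1 theta1 ufar).
- by move=> y Ay; apply: sub_gen_smallest; right.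
- by apply: sub_gen_smallest; left.
- by move=> q Aq; rewrite ltNge; apply/negP => xq; apply: nq; exists q.
Qed.

End NormedSpaces.

Theorem theorem4p1 (R : realType) (X : normedModType R)
    (U : Type) (kappa : set U) (theta : R) :
  infinite_dimensional X ->
  has_density [set: X] kappa ->
  1 < theta ->
  (forall Z : set X, linear_subspace Z -> density_lt Z kappa ->
     exists2 x : X, unit_sphere [set: X] x &
       (theta%:E <= dist_set x (unit_sphere Z))%E) ->
  (gamma_star X <= (2 / theta)%:E)%E.
Proof.
move=> infX [[D Ddense Dk] _] theta1 far.
have Dinf := infinite_spanning_set infX Ddense.
have [E ED Edense] := exists_dense_of_span Dinf Ddense.
have [lt [I [wf total trans ID Imin]]] := initial_well_order D.
have [e eE] : exists e : X -> X, E `<=` e @` I.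
  by move: ED; rewrite -(card_le_eqr ID) => /pcard_surjP.
have [p pP] : exists p : X -> X, forall i, I i ->
    good_extension (2 / theta) (e i) (p @` [set j | I j /\ lt j i]) (p i).
  apply: (well_founded_choice
    (good := fun i => good_extension (2 / theta) (e i))) => // i Ii B Ble.
  apply: exists_good_extension theta1 far _.
  exact: card_lt_setU1 Dinf Dk (Imin i Ii) Ble.
pose P := subgroup_span (p @` I).
have Psep : separated_set 2 P.
  apply: (separated_subgroup_span_image wf total trans) => i Ii.
  exact: (pP i Ii).2.
apply/lee_addgt0Pr => eps eps0; apply: ereal_inf_lbound.
exists (2 / theta + eps) => //.
have theta0 : 0 < theta by exact: lt_trans theta1.
split; first by rewrite addr_gt0// divr_gt0.
exists P; split=> //; first exact: subgroup_span_subgroup.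
move=> x.
have : closure E x by rewrite Edense.
move=> /closureP /(_ eps eps0) [_ /eE [i Ii <-] xe].
have [[q Pq eq] _] := pP i Ii.
exists q.
  apply: subgroup_spanS Pq => _ [[j [Ij _] <-]|->]; exact: imageP.
by rewrite -(subrKA (e i)) addrC (le_trans (ler_normD _ _))// lerD// ltW.
Qed.
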